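(* Let $k,n$ be positive integers such that $k\mid (n-3)$ and $n\ge 2k$. Then for every graph $G\in\mathcal{T}_{n,k}$, $$\rho(G)=\sqrt{\frac{n+2k-3}{k}}.$$
   Context: Graphs are finite, simple and undirected; $\rho(G)$ denotes the spectral radius of $G$, i.e. the largest eigenvalue of its adjacency matrix. Definition of the family $\mathcal{T}_{n,k}$. Let $k,n$ be positive integers with $k\mid(n-3)$ and $n\ge 2k$, and put $c:=(n+2k-3)/k$ (an integer). The family $\mathcal{T}_{n,k}$ consists of all graphs (up to isomorphism) obtained as follows. Take a tree $T_1$ on a vertex set $X=\{x_1,\dots,x_k\}$ satisfying $2d_{T_1}(x_i)\le c$ for all $i$, where $d_{T_1}(x_i)$ is the degree of $x_i$ in $T_1$. (1) Subdivide every edge of $T_1$ once: each edge $e=x_ix_j$ of $T_1$ is replaced by a new vertex $y_e$ adjacent exactly to $x_i$ and $x_j$ (so there are $k-1$ new vertices $y_e$, and no edges remain inside $X$). (2) Attach $f_i$ new pendant leaves to each $x_i$, where $f_i:=c-2d_{T_1}(x_i)\ge 0$. The resulting graph is a tree of order $n$. *)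

(* Defs.v *)
From mathcomp Require Import all_boot all_order all_algebra.
From mathcomp Require Import boolp classical_sets reals.

Set Implicit Arguments.
Unset Strict Implicit.
Unset Printing Implicit Defensive.

Import Order.TTheory GRing.Theory Num.Theory.

Record sgraph (V : finType) := SGraph {
  adj :> rel V;
  adj_sym : symmetric adj;
  adj_irrefl : irreflexive adj
}.

Definition deg (V : finType) (G : sgraph V) (x : V) : nat := #|[set y | G x y]|.

Definition graph_iso (V W : finType) (G : sgraph V) (H : sgraph W) : Prop :=
  exists2 f : V -> W, bijective f & forall x y, H (f x) (f y) = G x y.

(* [ucycle] also accepts the closed walk x - y - x along a single edge; only
   sequences of length at least 3 are cycles of a simple graph. *)
Definition acyclic (V : finType) (G : sgraph V) : Prop :=
  forall p : seq V, ucycle G p -> size p <= 2.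

Definition connected_graph (V : finType) (G : sgraph V) : Prop :=
  0 < #|V| /\ forall x y : V, connect G x y.

Definition is_tree (V : finType) (G : sgraph V) : Prop :=
  connected_graph G /\ acyclic G.

Definition is_edge (V : finType) (G : sgraph V) (s : {set V}) : bool :=
  [exists x, exists y, G x y && (s == [set x; y])].

Definition edge (V : finType) (G : sgraph V) : finType :=
  {s : {set V} | is_edge G s}.

(* [inl x] is an original vertex, [inr s] the vertex subdividing the edge s. *)
Definition subdiv_rel (V : finType) (G : sgraph V) : rel (V + edge G)%type :=
  fun u v => match u, v with
  | inl x, inr s | inr s, inl x => x \in val s
  | _, _ => false
  end.

Lemma subdiv_sym (V : finType) (G : sgraph V) : symmetric (subdiv_rel (G := G)).
Proof. by case=> ? []. Qed.

Lemma subdiv_irrefl (V : finType) (G : sgraph V) :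
  irreflexive (subdiv_rel (G := G)).
Proof. by case. Qed.

Definition subdivide (V : finType) (G : sgraph V) : sgraph (V + edge G)%type :=
  SGraph (@subdiv_sym V G) (@subdiv_irrefl V G).

(* [inr (Tagged _ i)] with tag x is the i-th leaf attached to x. *)
Definition leaves_rel (V : finType) (G : sgraph V) (f : V -> nat) :
    rel (V + {x : V & 'I_(f x)})%type :=
  fun u v => match u, v with
  | inl x, inl y => G x y
  | inl x, inr l | inr l, inl x => tag l == x
  | inr _, inr _ => false
  end.

Lemma leaves_sym (V : finType) (G : sgraph V) (f : V -> nat) :
  symmetric (leaves_rel G (f := f)).
Proof. by case=> x [] y //=; exact: adj_sym. Qed.

Lemma leaves_irrefl (V : finType) (G : sgraph V) (f : V -> nat) :
  irreflexive (leaves_rel G (f := f)).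
Proof. by case=> //= x; exact: adj_irrefl. Qed.

Definition attach_leaves (V : finType) (G : sgraph V) (f : V -> nat) :
    sgraph (V + {x : V & 'I_(f x)})%type :=
  SGraph (@leaves_sym V G f) (@leaves_irrefl V G f).

(* The division is exact when k divides n - 3, and the subtraction is not
   truncated when n >= 2k and k > 0. *)
Definition Tparam (n k : nat) : nat := (n + 2 * k - 3) %/ k.

Definition Tleaves (k : nat) (T1 : sgraph 'I_k) (c : nat)
    (u : 'I_k + edge T1) : nat :=
  match u with
  | inl x => c - 2 * deg T1 x
  | inr _ => 0
  end.

Definition Tgraph (k : nat) (T1 : sgraph 'I_k) (c : nat) :=
  attach_leaves (subdivide T1) (@Tleaves k T1 c).

Definition Tfamily (n k : nat) (V : finType) (G : sgraph V) : Prop :=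
  exists T1 : sgraph 'I_k,
    [/\ is_tree T1,
        forall x : 'I_k, 2 * deg T1 x <= Tparam n k
      & graph_iso G (Tgraph T1 (Tparam n k))].

Local Open Scope ring_scope.

Definition adj_mx (R : realType) (V : finType) (G : sgraph V) : 'M[R]_#|V| :=
  \matrix_(i, j) (G (enum_val i) (enum_val j))%:R.

Definition is_largest_eigenvalue (R : realType) (m : nat) (A : 'M[R]_m)
    (a : R) : Prop :=
  eigenvalue A a /\ forall b : R, eigenvalue A b -> b <= a.

(* The largest eigenvalue of the adjacency matrix; the default value 0 is only
   taken when V is empty. *)
Definition spectral_radius (R : realType) (V : finType) (G : sgraph V) : R :=
  xget 0 [set a : R | is_largest_eigenvalue (adj_mx R G) a]%classic.

(* Main.v *)
Require Import Defs.
From mathcomp Require Import all_boot all_order all_algebra.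
From mathcomp Require Import boolp classical_sets reals.
From mathcomp Require Import zify.

Set Implicit Arguments.
Unset Strict Implicit.
Unset Printing Implicit Defensive.

Import Order.TTheory GRing.Theory Num.Theory.
Local Open Scope ring_scope.

(** The proof exhibits a Perron vector.  Put [c := (n + 2k - 3) / k] and weigh
    the tree by [sqrt c] on the original vertices [x_i], by [2] on the
    subdividing vertices and by [1] on the leaves.  The neighbours of [x_i] are
    [d(x_i)] subdividing vertices and [c - 2 d(x_i)] leaves, of total weight
    [c = sqrt c * sqrt c]; a subdividing vertex sees two original vertices, of
    total weight [2 * sqrt c]; a leaf sees one, of weight [sqrt c].  So this
    positive vector is an eigenvector for [sqrt c] ([Tgraph_perron]), and an
    eigenvalue with a positive eigenvector is the largest one
    ([positive_eigenvector_bound], [spectral_radius_perron]). *)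

(** Pairing [|z|] with [w], where [z] is an eigenvector for [b], gives
    [b <|z|, w> <= <|z| A, w> = <|z|, A w> = rho <|z|, w>], and
    [<|z|, w> > 0] because [z != 0] and [w] is positive. *)
Lemma positive_eigenvector_bound (R : realFieldType) (m : nat) (A : 'M[R]_m)
    (w : 'I_m -> R) (rho b : R) :
  (forall i j, 0 <= A i j) -> (forall i, 0 < w i) ->
  (forall i, \sum_j A i j * w j = rho * w i) ->
  eigenvalue A b -> b <= rho.
Proof.
move=> A_ge0 w_gt0 Aw /eigenvalueP[z zA z_neq0].
have [i0 zi0] : exists i, z 0 i != 0.
  by case/rV0Pn: z_neq0 => i zi; exists i.
have zw_gt0 : 0 < \sum_i `|z 0 i| * w i.
  rewrite (bigD1 i0) //= ltr_pwDl ?mulr_gt0 ?normr_gt0 //.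
  by apply: sumr_ge0 => i _; rewrite mulr_ge0 ?normr_ge0 ?ltW.
rewrite -(ler_pM2r zw_gt0) !mulr_sumr.
apply: (@le_trans _ _ (\sum_j (\sum_i `|z 0 i| * A i j) * w j)).
  apply: ler_sum => j _; rewrite mulrA ler_wpM2r ?(ltW (w_gt0 j)) //.
  apply: (@le_trans _ _ `|(z *m A) 0 j|).
    by rewrite zA mxE normrM ler_wpM2r ?normr_ge0 ?ler_norm.
  rewrite mxE; apply: le_trans (ler_norm_sum _ _ _) _.
  by apply: ler_sum => i _; rewrite normrM (ger0_norm (A_ge0 _ _)).
under eq_bigr do rewrite mulr_suml.
rewrite exchange_big /=; apply: ler_sum => i _.
under eq_bigr do rewrite -mulrA.
by rewrite -mulr_sumr Aw mulrCA.
Qed.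

Lemma spectral_radius_eq (R : realType) (V : finType) (G : sgraph V) (a : R) :
  is_largest_eigenvalue (adj_mx R G) a -> spectral_radius R G = a.
Proof.
move=> a_max; rewrite /spectral_radius; case: xgetP => [b _ b_max|none].
  by apply/eqP; rewrite eq_le (b_max.2 _ a_max.1) (a_max.2 _ b_max.1).
by case: (none a).
Qed.

(** The adjacency matrix is symmetric, so [w] is also a row eigenvector, as
    [eigenvalue] requires; it is nonzero because there is a vertex. *)
Lemma spectral_radius_perron (R : realType) (V : finType) (G : sgraph V)
    (w : V -> R) (rho : R) :
  (0 < #|V|)%N -> (forall v, 0 < w v) ->
  (forall v, \sum_(u | G v u) w u = rho * w v) ->
  spectral_radius R G = rho.
Proof.
move=> V_gt0 w_gt0 Gw.
have Aw i : \sum_j adj_mx R G i j * w (enum_val j) = rho * w (enum_val i).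
  rewrite -Gw (reindex _ (onW_bij _ (enum_val_bij V))) [RHS]big_mkcond /=.
  apply: eq_bigr => j _; rewrite mxE.
  by case: ifP => _; rewrite ?mul1r ?mul0r.
apply: spectral_radius_eq; split; last first.
  move=> b; apply: positive_eigenvector_bound Aw => // i j.
  by rewrite mxE ler0n.
apply/eigenvalueP; exists (\row_j w (enum_val j)).
  apply/rowP => j; rewrite !mxE -Aw; apply: eq_bigr => i _.
  by rewrite !mxE mulrC adj_sym.
by apply/rV0Pn; exists (Ordinal V_gt0); rewrite mxE gt_eqF.
Qed.

(** A positive eigenvector pulls back along an isomorphism. *)
Lemma perron_iso (R : realType) (V W : finType) (G : sgraph V) (H : sgraph W)
    (w : W -> R) (rho : R) :
  graph_iso G H -> (0 < #|W|)%N -> (forall v, 0 < w v) ->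
  (forall v, \sum_(u | H v u) w u = rho * w v) ->
  spectral_radius R G = rho.
Proof.
move=> [f f_bij fG] W_gt0 w_gt0 Hw.
apply: (@spectral_radius_perron _ _ _ (w \o f)) => //=.
- by rewrite (bij_eq_card f_bij).
- move=> v; rewrite -Hw (reindex f) /=; last exact: onW_bij.
  by apply: eq_bigl => u; rewrite fG.
Qed.

Lemma card_edge_ends (V : finType) (G : sgraph V) (e : edge G) :
  #|val e| = 2.
Proof.
case: e => s /= /existsP[x /existsP[y /andP[xy /eqP->]]].
by rewrite cards2; case: eqVneq xy => // ->; rewrite adj_irrefl.
Qed.

Lemma is_edge_set2 (V : finType) (G : sgraph V) (x y : V) :
  G x y -> is_edge G [set x; y].
Proof.
by move=> xy; apply/existsP; exists x; apply/existsP; exists y; rewrite xy eqxx.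
Qed.

(** The map [y |-> {x, y}] is a bijection from the neighbours of [x] to the
    edges at [x]. *)
Lemma card_incident_edges (V : finType) (G : sgraph V) (x : V) :
  #|[set e : edge G | x \in val e]| = deg G x.
Proof.
have -> : #|[set e : edge G | x \in val e]|
        = #|[set val e | e in [set e : edge G | x \in val e]]|.
  by rewrite card_imset //; exact: val_inj.
have -> : [set val e | e in [set e : edge G | x \in val e]]
        = [set [set x; y] | y in [set y | G x y]].
  apply/setP => s; apply/imsetP/imsetP => [[e] | [y]].
    rewrite inE => xe ->; move: xe; case: e => t /= /existsP[a /existsP[b]].
    (* [x] is either of the two ends in the chosen writing of the edge. *)
    case/andP=> ab /eqP->; rewrite !inE => /orP[]/eqP->.
      by exists b; rewrite ?inE.
    by exists a; rewrite ?inE 1?adj_sym // finset.setUC.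
  rewrite inE => xy ->.
  exists (exist (fun t => is_edge G t) _ (is_edge_set2 xy)) => //.
  by rewrite !inE eqxx.
rewrite card_in_imset // => y z; rewrite !inE => xy xz eq_yz.
have : y \in [set x; z] by rewrite -eq_yz set22.
by rewrite !inE => /orP[/eqP yx|/eqP//]; rewrite yx adj_irrefl in xy.
Qed.

(** The Perron vector: scaled so that a leaf has weight 1, which makes its
    neighbour weigh the eigenvalue [sqrt c] itself. *)
Definition Tweight (R : realType) (k : nat) (T1 : sgraph 'I_k) (c : nat)
    (v : 'I_k + edge T1 + {u : 'I_k + edge T1 & 'I_(@Tleaves k T1 c u)}) : R :=
  match v with
  | inl (inl _) => Num.sqrt c%:R
  | inl (inr _) => 2
  | inr _ => 1
  end.

Lemma card_leaves_at (I : finType) (f : I -> nat) (x : I) :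
  #|[pred l : {x : I & 'I_(f x)} | tag l == x]| = f x.
Proof.
pose leaf (i : 'I_(f x)) := Tagged (fun y => 'I_(f y)) i.
have leaf_inj : injective leaf by move=> i j /eqP; rewrite eq_Tagged => /eqP.
rewrite -[RHS]card_ord -(card_codom leaf_inj); apply: eq_card => l.
rewrite inE; apply/eqP/codomP => [|[i ->] //].
by case: l => y i /= yx; rewrite /leaf {leaf leaf_inj}; subst x; exists i.
Qed.

Lemma Tgraph_perron (R : realType) (k : nat) (T1 : sgraph 'I_k) (c : nat) :
  (forall x, 2 * deg T1 x <= c)%N ->
  forall v, \sum_(u | Tgraph T1 c v u) Tweight R u
            = Num.sqrt c%:R * Tweight R v.
Proof.
move=> deg_le [[x|e]|[u i]]; rewrite !big_sumType /=.
- rewrite big_pred0_eq add0r.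
  have sqr_c : Num.sqrt c%:R * Num.sqrt c%:R = c%:R :> R.
    by rewrite -expr2 sqr_sqrtr ?ler0n.
  rewrite !sumr_const sqr_c card_leaves_at -cardsE card_incident_edges /=.
  by rewrite -mulrnA -natrD subnKC.
- rewrite !big_pred0_eq sumr_const.
  rewrite (eq_card (_ : _ =i val e)) // card_edge_ends.
  (* A subdividing vertex carries no leaves: the index type is ['I_0]. *)
  rewrite big_pred0 ?addr0 ?mulr_natr // => -[u [i lt_i]] /=.
  by apply/eqP => eu; rewrite eu in lt_i.
- (* The case of a leaf attached to a subdividing vertex is vacuous. *)
  case: u i => [x|e] [i lt_i] //=; rewrite big_pred0_eq addr0.
  rewrite (big_pred1 x) ?mulr1; last by move=> y; rewrite eq_sym.
  by rewrite big_pred0 ?addr0.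
Qed.

Lemma Tparam_natr (R : realType) (n k : nat) :
  (0 < k)%N -> (k%:Z %| n%:Z - 3)%Z -> (2 * k <= n)%N ->
  (Tparam n k)%:R = (n%:R + 2 * k%:R - 3) / k%:R :> R.
Proof.
move=> k_gt0 k_dvd le_kn.
have le3 : (3 <= n + 2 * k)%N by lia.
have k_dvdn : (k %| n + 2 * k - 3)%N.
  have : (k%:Z %| n%:Z - 3 + k%:Z * 2)%Z by rewrite rpredD ?dvdz_mulr.
  by have -> : n%:Z - 3 + k%:Z * 2 = (n + 2 * k - 3)%N by lia.
apply/(canRL (mulfK _)); first by rewrite pnatr_eq0 -lt0n.
by rewrite /Tparam -[LHS]natrM divnK // natrB // natrD natrM.
Qed.

Theorem proposition4 (R : realType) (n k : nat)
  (hk : (0 < k)%N) (hn : (0 < n)%N)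
  (hdvd : (k%:Z %| n%:Z - 3)%Z) (hnk : (2 * k <= n)%N)
  (V : finType) (G : sgraph V) (hG : Tfamily n k G) :
  spectral_radius R G = Num.sqrt ((n%:R + 2 * k%:R - 3) / k%:R).
Proof.
case: hG => T1 [_ deg_le isoG]; rewrite -Tparam_natr //.
have c_gt0 : (0 < Tparam n k)%N by rewrite divn_gt0 //; lia.
apply: perron_iso isoG _ _ (Tgraph_perron R deg_le).
- by apply/card_gt0P; exists (inl (inl (Ordinal hk))).
- by case=> [[]|] //= _; rewrite sqrtr_gt0 ltr0n.
Qed.
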